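(* For every nonprincipal ultrafilter $u$ on $\omega$, the continuum $\mathbb{I}_u$ maps continuously onto every continuum of weight $\aleph_1$.
   Context: A continuum is a (nonempty) compact connected Hausdorff space. The weight of a space is the least cardinality of a base for its topology. Let $\mathbb{I}=[0,1]$ and $\mathbb{M}=\omega\times\mathbb{I}$ ($\omega$ discrete). For a nonprincipal ultrafilter $u$ on $\omega$ (a point of $\omega^*=\beta\omega\setminus\omega$) put $\mathbb{I}_u=\bigcap_{U\in u}\operatorname{cl}(U\times\mathbb{I})$, closures being taken in the Čech–Stone compactification $\beta\mathbb{M}$; this is a component of $\mathbb{M}^*=\beta\mathbb{M}\setminus\mathbb{M}$. *)

(* Defs.v *)
From mathcomp Require Import all_boot all_order all_algebra.
From mathcomp Require Import all_classical all_reals all_analysis.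

Set Implicit Arguments.
Unset Strict Implicit.
Unset Printing Implicit Defensive.

Import Order.TTheory GRing.Theory Num.Theory.
Import numFieldNormedType.Exports.

Local Open Scope classical_set_scope.
Local Open Scope ring_scope.
Local Open Scope card_scope.

(* [connected] holds of the empty set, so nonemptiness is required separately. *)
Definition continuum (X : topologicalType) : Prop :=
  [/\ [set: X] !=set0, compact [set: X], connected [set: X]
    & hausdorff_space X].

(* A set of cardinality aleph_1, the least uncountable cardinal. *)
Definition card_aleph1 (T : Type) (A : set T) : Prop :=
  ~ countable A /\
  forall (T' : Type) (B : set T'), ~ countable B -> A #<= B.

(* The least cardinality of a base is attained by a base of size aleph_1. *)
Definition weight_aleph1 (X : topologicalType) : Prop :=
  exists B : set (set X),
    [/\ basis B, card_aleph1 B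
      & forall B' : set (set X), basis B' -> B #<= B'].

Section StoneCech.
Variable R : realType.

Definition unitI : topologicalType := set_type `[0 : R, 1]%classic.

Section Beta.
Variable X : topologicalType.

(* The evaluation map x |-> (f x)_f into the cube indexed by C(X, [0,1]);
   it is an embedding when X is a Tychonoff space. *)
Definition cube_eval (x : X) : {ptws continuousType X unitI -> unitI} :=
  fun f => f x.

Definition beta : topologicalType := set_type (closure (range cube_eval)).

Lemma cube_eval_closure (x : X) : cube_eval x \in closure (range cube_eval).
Proof. by apply/mem_set/subset_closure; exists x. Qed.

Definition beta_embed (x : X) : beta := SigSub (cube_eval_closure x).

End Beta.

(* The canonical topology on [nat] is discrete. *)
Definition Mspace : topologicalType := (nat * unitI)%type.

Definition I_u (u : set_system nat) : set (beta Mspace) :=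
  \bigcap_(U in u) closure (@beta_embed Mspace @` (U `*` [set: unitI])).

End StoneCech.

Definition nonprincipal (u : set_system nat) : Prop :=
  forall n : nat, u <> principal_filter n.

Definition maps_onto (X Y : topologicalType) : Prop :=
  exists f : X -> Y, continuous f /\ range f = [set: Y].

(* Main.v *)
Require Import Defs.
From HB Require Import structures.
From Stdlib Require List.
From mathcomp Require Import all_boot all_order all_algebra.
From mathcomp Require Import all_classical all_reals all_analysis.
From mathcomp Require Import wochoice ring lra.

Set Implicit Arguments.
Unset Strict Implicit.
Unset Printing Implicit Defensive.

Import Order.TTheory GRing.Theory Num.Theory.
Import numFieldNormedType.Exports.

(** Let I = [0,1] and let phi_a : X -> I, for a in a set A of size aleph_1, be
continuous functions separating the points of X (lemma [separating_family]).
A family g_a = (g_(a,n))_n of sequences of continuous maps I -> I glues to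
continuous functions on M = omega x I; these are coordinates on beta M, hence
functions c_a on I_u.  The map F : I_u -> X is the one with phi_a o F = c_a.
For it to exist, be continuous and be onto, it is enough that for every finite
set s of indices the curves t |-> (g_(a,n)(t))_(a in s) converge along u, in the
Hausdorff metric, to the image of X under (phi_a)_(a in s).

For a single finite s there are such curves because X is connected: its points
can be joined by chains with small steps, and one chain visits a finite net of
X; joining the values of phi_a along the chain linearly gives a curve
([curve_through_continuum]).  The difficulty is to choose the g_a for all
aleph_1 many indices coherently: a careless choice of g_b for b < a may admit no
g_a at all, since a curve close to one image of X need not lift to a curve close
to a finer one.

The remedy is model theory.  Index the curves above by pairs (s, k) of a finite
set and a precision, and take an ultrafilter V on these pairs containing all
tails: in the corresponding ultrapower of C(I,I), the classes f_a of the families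
of curves have all the wanted properties at once.  Now C(I,I) carries a countable
relational language that can say that a tuple of functions enters a rational
box, and the two ultrapowers, by V and by u, are elementarily equivalent.
Well-order A so that all initial segments are countable ([aleph1_omega1_like],
where the cardinality of the base enters) and build g_a by recursion so that (g_b)_(b <= a) satisfies,
modulo u, the same first-order formulas as (f_b)_(b <= a) modulo V.  A step is
possible because ultrapowers by a free ultrafilter on omega realize countable
types ([countably_saturated], [elementary_extend]); as the whole first-order
theory is preserved, a choice made at one stage never obstructs a later one
([elementary_transfer]).  In particular the g_a enter the same rational boxes as
the f_a, which is [approximating_family]. *)

Local Open Scope classical_set_scope.

(** * First-order formulas over a relational language *)

(** Variables are de Bruijn indices.  [FTrue] is present so that there is a
formula also when the language has no relation symbol. *)
Inductive form (L : Type) : Type :=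
| FTrue
| FRel of L & seq nat
| FNot of form L
| FAnd of form L & form L
| FEx of form L.

(** The formulas are encoded as trees to show that a countable language has
countably many of them, which is what makes types over countable sets countable. *)
Fixpoint form_encode (L : Type) (p : form L) : GenTree.tree (L * seq nat) :=
  match p with
  | FTrue => GenTree.Node 3 [::]
  | FRel r s => GenTree.Leaf (r, s)
  | FNot p => GenTree.Node 0 [:: form_encode p]
  | FAnd p q => GenTree.Node 1 [:: form_encode p; form_encode q]
  | FEx p => GenTree.Node 2 [:: form_encode p]
  end.

Fixpoint form_decode (L : Type) (t : GenTree.tree (L * seq nat)) :
    option (form L) :=
  match t with
  | GenTree.Node 3 [::] => Some (FTrue L)
  | GenTree.Leaf rs => Some (FRel rs.1 rs.2)
  | GenTree.Node 0 [:: t] => omap (@FNot L) (form_decode t)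
  | GenTree.Node 1 [:: t; s] =>
      obind (fun p => omap (FAnd p) (form_decode s)) (form_decode t)
  | GenTree.Node 2 [:: t] => omap (@FEx L) (form_decode t)
  | _ => None
  end.

Lemma form_encodeK (L : Type) : pcancel (@form_encode L) (@form_decode L).
Proof. by elim=> [|r s|p /= ->|p /= -> q /= ->|p /= ->]. Qed.

HB.instance Definition _ (L : eqType) :=
  Equality.copy (form L) (pcan_type (@form_encodeK L)).
HB.instance Definition _ (L : choiceType) :=
  Choice.copy (form L) (pcan_type (@form_encodeK L)).
HB.instance Definition _ (L : countType) :=
  Countable.copy (form L) (pcan_type (@form_encodeK L)).

Section Satisfaction.
Variables (L M : Type) (rel : L -> seq M -> Prop).

Definition scons (T : Type) (x : T) (e : nat -> T) (i : nat) : T :=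
  if i is j.+1 then e j else x.

Fixpoint sat (e : nat -> M) (p : form L) : Prop :=
  match p with
  | FTrue => True
  | FRel r s => rel r (map e s)
  | FNot p => ~ sat e p
  | FAnd p q => sat e p /\ sat e q
  | FEx p => exists m, sat (scons m e) p
  end.

Fixpoint ren (r : nat -> nat) (p : form L) : form L :=
  match p with
  | FTrue => FTrue L
  | FRel l s => FRel l (map r s)
  | FNot p => FNot (ren r p)
  | FAnd p q => FAnd (ren r p) (ren r q)
  | FEx p => FEx (ren (scons 0 (S \o r)) p)
  end.

Lemma scons_comp (A B : Type) (h : A -> B) x e :
  h \o scons x e = scons (h x) (h \o e).
Proof. by apply/funext => -[]. Qed.

Lemma sat_ren p r e : sat e (ren r p) <-> sat (e \o r) p.
Proof.
elim: p r e => [|l s|p IH|p IHp q IHq|p IH] r e /=.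
- by [].
- by rewrite -map_comp.
- by rewrite IH.
- by rewrite IHp IHq.
- have E m : scons m e \o scons 0 (S \o r) = scons m (e \o r).
    by rewrite scons_comp.
  by split=> -[m]; [rewrite IH E|rewrite -E -IH]; exists m.
Qed.

(** A formula depends on finitely many variables only.  This is what allows
elementarity to pass to unions of chains of sets of parameters. *)
Lemma sat_finite p : exists N : nat, forall e e',
  (forall i, i < N -> e i = e' i)%N -> sat e p <-> sat e' p.
Proof.
elim: p => [|l s|p [N IH]|p [N IHp] q [N' IHq]|p [N IH]].
- by exists 0.
- exists (\max_(i <- s) i.+1) => e e' ee' /=; rewrite (_ : map e s = map e' s)//.
  by apply/eq_in_map => i si; apply: ee'; apply: leq_bigmax_seq.
- by exists N => e e' /IH /= ->.
- exists (maxn N N') => e e' ee' /=.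
  by rewrite (IHp e e') ?(IHq e e')// => i iN; apply: ee';
    rewrite leq_max iN ?orbT.
- exists N => e e' ee' /=.
  have E m : sat (scons m e) p <-> sat (scons m e') p.
    by apply: IH => -[|i] //= /ltnW; apply: ee'.
  by split=> -[m /E]; exists m.
Qed.

End Satisfaction.

(** * Elementary transfer between ultrapowers *)

Lemma ultra_not (T : Type) (F : set_system T) (P : T -> Prop) :
  UltraFilter F -> F [set x | ~ P x] <-> ~ F [set x | P x].
Proof.
move=> FU; split=> [FnP FP|nFP].
  by have [x []] := filter_ex (filterI FP FnP).
by have [//|] := in_ultra_setVsetC [set x | P x] FU.
Qed.

Lemma filter_and (T : Type) (F : set_system T) (P Q : T -> Prop) :
  Filter F -> F [set x | P x /\ Q x] <-> F [set x | P x] /\ F [set x | Q x].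
Proof.
move=> FF; split=> [FPQ|[FP FQ]]; last exact: filterI.
by split; apply: filterS FPQ => x [].
Qed.

Lemma filter_const (T : Type) (F : set_system T) (P : Prop) :
  ProperFilter F -> F [set _ | P] <-> P.
Proof.
by move=> FF; split=> [/filter_ex[]//|p]; apply: filterS filterT => ? _.
Qed.

(** Countable saturation of ultrapowers by a free ultrafilter on the integers.
At index n, pick a witness for the longest conjunction of Q_0, ..., Q_k with
k < n that has one; for each k this is a witness of Q_k for u-almost all n. *)
Lemma countably_saturated (M : Type) (m0 : M) (u : set_system nat)
    (Q : nat -> nat -> M -> Prop) :
  Filter u -> (forall n, u [set k | n <= k]%N) ->
  (forall k, u [set n | exists m, forall j, (j <= k)%N -> Q j n m]) ->
  exists h : nat -> M, forall k, u [set n | Q k n (h n)].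
Proof.
move=> uF ufree uQ.
have best n N : exists m, forall k, (k < N)%N ->
    (exists m', forall j, (j <= k)%N -> Q j n m') -> Q k n m.
  elim: N => [|N [m IH]]; first by exists m0.
  have [[m' Hm']|no] := pselect (exists m', forall j, (j <= N)%N -> Q j n m').
    by exists m' => k kN _; apply: Hm'.
  exists m => k; rewrite ltnS leq_eqVlt => /predU1P[->//|]; exact: IH.
have [h hP] := choice (fun n => best n n).
exists h => k; apply: filterS (filterI (uQ k) (ufree k.+1)) => n [Qn kn].
exact: hP Qn.
Qed.

Section Transfer.
Variables (L : countType) (M : Type) (rel : L -> seq M -> Prop) (m0 : M).
Variables (P : Type) (V : set_system P) (u : set_system nat).
Hypotheses (VU : UltraFilter V) (uU : UltraFilter u).
Hypothesis ufree : forall n, u [set k | n <= k]%N.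
Variables (A : Type) (f : A -> P -> M).

(** [None] stands for the fixed element [m0]; thanks to it there are
environments over an empty set of parameters. *)
Definition env (I : Type) (h : A -> I -> M) (e : nat -> option A) (i : I) :
  nat -> M := fun k => if e k is Some a then h a i else m0.

(** The classes of the [g a] modulo [u] and of the [f a] modulo [V], for [a] in
[S], have the same first-order theory.  By Los' theorem, truth of a formula in an
ultrapower means truth at almost all indices, which is taken as the definition;
the ultrapowers need not be formed. *)
Definition elementary_on (S : set A) (g : A -> nat -> M) : Prop :=
  forall p (e : nat -> option A), (forall k a, e k = Some a -> S a) ->
    V [set i | sat rel (env f e i) p] <-> u [set n | sat rel (env g e n) p].

Lemma countable_enum (S : set A) : countable S ->
  exists c : nat -> option A, [/\ forall k a, c k = Some a -> S a,
    forall a, S a -> exists k, c k = Some a & c 0%N = None].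
Proof.
move=> /countable_injP[j jinj].
have H k : exists o : option A, [/\ forall a, o = Some a -> S a,
    forall a, S a -> (j a).+1 = k -> o = Some a & k = 0%N -> o = None].
  have [[a [Sa ja]]|no] := pselect (exists a, S a /\ (j a).+1 = k).
    exists (Some a); split=> [b [<-]//|b Sb|k0]; last by rewrite k0 in ja.
    by rewrite -ja => -[] /jinj ->; rewrite ?inE.
  by exists None; split=> // a Sa ja; case: no; exists a.
have [c cP] := choice H.
exists c; split=> [k a|a Sa|]; first by have [+ _ _] := cP k; apply.
- by exists (j a).+1; have [_ + _] := cP (j a).+1; apply.
- by have [_ _ ->] := cP 0%N.
Qed.

Lemma env_scons (I : Type) (h : A -> I -> M) a c i :
  env h (scons (Some a) c) i = scons (h a i) (env h c i).
Proof. by apply/funext => -[]. Qed.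

Lemma env_congr (I : Type) (h h' : A -> I -> M) (e : nat -> option A) :
  (forall k a, e k = Some a -> h a = h' a) -> env h e = env h' e.
Proof.
move=> hh'; apply/funext => i; apply/funext => k.
by rewrite /env; case E : (e k) => [a|//]; rewrite (hh' k).
Qed.

(** One step of the back-and-forth construction.  If p is in the type of f_a0
over the parameters in S, then so is the existence of a witness for it; hence the
corresponding type over the g_a is finitely satisfiable, and saturation realizes
it. *)
Lemma elementary_extend (S : set A) (g : A -> nat -> M) (a0 : A) :
  countable S -> elementary_on S g ->
  exists h : nat -> M, forall g' : A -> nat -> M,
    (forall a, S a -> g' a = g a) -> g' a0 = h ->
    elementary_on (a0 |` S) g'.
Proof.
move=> /countable_enum[c [cS Sc c0]] gS.
pose c' := scons (Some a0) c.
pose Q j n m := if unpickle j is Some p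
  then V [set i | sat rel (env f c' i) p] -> sat rel (scons m (env g c n)) p
  else True.
(* Finitely many formulas of the type reduce to one, their conjunction. *)
have finconj k : exists p, V [set i | sat rel (env f c' i) p] /\
    forall n m, sat rel (scons m (env g c n)) p ->
    forall j, (j < k)%N -> Q j n m.
  elim: k => [|k [p [Vp pP]]].
    by exists (FTrue L); split=> //; exact: filterS filterT.
  suff [q [Vq qP]] : exists q, V [set i | sat rel (env f c' i) q] /\
      forall n m, sat rel (scons m (env g c n)) q -> Q k n m.
    exists (FAnd p q); split=> /=; first exact/filter_and.
    move=> n m [sp sq] j; rewrite ltnS leq_eqVlt => /predU1P[->|]; first exact: qP.
    exact: pP.
  rewrite /Q; case: (unpickle k) => [q|]; last first.
    by exists (FTrue L); split=> //; exact: filterS filterT.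
  have [Vq|nVq] := pselect (V [set i | sat rel (env f c' i) q]).
    by exists q.
  by exists (FTrue L); split=> //; exact: filterS filterT.
have uQ k : u [set n | exists m, forall j, (j <= k)%N -> Q j n m].
  have [p [Vp pP]] := finconj k.+1.
  have /gS : V [set i | sat rel (env f c i) (FEx p)].
    by apply: filterS Vp => i /=; rewrite env_scons => sp; exists (f a0 i).
  by move=> /(_ cS); apply: filterS => n /= [m /pP Hm]; exists m => j /Hm.
have [h hP] := countably_saturated m0 _ ufree uQ.
exists h => g' g'S g'h.
have Eg n : env g' c' n = scons (h n) (env g c n).
  by rewrite env_scons g'h (@env_congr _ g' g)// => k a /cS; exact: g'S.
have c'fwd p : V [set i | sat rel (env f c' i) p] ->
    u [set n | sat rel (env g' c' n) p].
  move=> Vp; have := hP (pickle p); rewrite /Q pickleK.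
  by apply: filterS => n /= /(_ Vp); rewrite Eg.
have c'P p : V [set i | sat rel (env f c' i) p] <->
    u [set n | sat rel (env g' c' n) p].
  split; first exact: c'fwd.
  move=> up; apply: contrapT => /(ultra_not _ VU)/(c'fwd (FNot p)) /=.
  by move/(ultra_not _ uU).
(* An environment over a0 |` S is a renaming of c', which is universal. *)
move=> p e eS.
have /choice[r rP] : forall k, exists l, e k = c' l.
  move=> k; case E : (e k) => [a|]; last by exists 1%N.
  have [->|/Sc[l cl]] := eS _ _ E; first by exists 0%N.
  by exists l.+1.
have E I (k : A -> I -> M) i : env k e i = env k c' i \o r.
  by apply/funext => l; rewrite /env /= rP.
have ES I (k : A -> I -> M) : [set i | sat rel (env k e i) p] =
    [set i | sat rel (env k c' i) (ren r p)].
  by apply/seteqP; split=> i /=; rewrite E sat_ren.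
by rewrite !ES.
Qed.

(** Elementarity on the members of [B] gives it on any set whose finite subsets
are covered by members of [B]; the alternative [D = set0] is there because a
formula about [m0] alone has the same meaning at all indices. *)
Lemma elementary_finite (B : set (set A)) (g : A -> nat -> M) (S : set A) :
  (forall D, B D -> elementary_on D g) ->
  (forall s : seq A, (forall a, List.In a s -> S a) ->
    exists2 D, D = set0 \/ B D & forall a, List.In a s -> D a) ->
  elementary_on S g.
Proof.
move=> BP Bfin p e eS.
have [N pN] := sat_finite rel p.
pose e' k := if (k < N)%N then e k else None.
pose s := pmap e' (iota 0 N).
have e's k a : e' k = Some a -> List.In a s.
  move=> ek; have kN : (k < N)%N by move: ek; rewrite /e'; case: ifP.
  rewrite /s; have : k \in iota 0 N by rewrite mem_iota.
  elim: (iota 0 N) => //= l t IH; rewrite inE => /predU1P[<-|/IH].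
    by rewrite ek; left.
  by case: (e' l) => [b|] //=; right.
have sS a : List.In a s -> S a.
  rewrite /s; elim: (iota 0 N) => //= l t IH.
  case E : (e' l) => [b|] //= -[<-|/IH//].
  by move: E; rewrite /e'; case: ifP => // _; exact: eS.
have ES I (k : A -> I -> M) : [set i | sat rel (env k e i) p] =
    [set i | sat rel (env k e' i) p].
  apply/seteqP; split=> i /=; rewrite (pN _ (env k e' i))// => l lN;
    by rewrite /env /e' lN.
rewrite !ES; have [D [D0|/BP DB] sD] := Bfin s sS; last first.
  by apply: DB => k a /e's/sD.
have e'0 k : e' k = None.
  by case E : (e' k) => [a|//]; have := sD a (e's _ _ E); rewrite D0.
have E0 I (k : A -> I -> M) i : env k e' i = fun=> m0.
  by apply/funext => l; rewrite /env e'0.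
have -> : [set i | sat rel (env f e' i) p] = [set i | sat rel (fun=> m0) p].
  by apply/funext => i; rewrite /= E0.
have -> : [set i | sat rel (env g e' i) p] = [set i | sat rel (fun=> m0) p].
  by apply/funext => i; rewrite /= E0.
by rewrite !filter_const.
Qed.

Section Recursion.
Variable lt : A -> A -> Prop.
Hypothesis lt_wf : well_founded lt.
Hypothesis lt_trans : forall a b c, lt a b -> lt b c -> lt a c.
Hypothesis lt_total : forall a b, [\/ lt a b, a = b | lt b a].
Hypothesis lt_countable : forall a, countable [set b | lt b a].

Let upto a : set A := a |` [set b | lt b a].

(** As [elementary_on] speaks of families indexed by all of [A], a family [h] known
below [a] only is replaced by its total extensions [g']. *)
Let next_spec a (h : forall b, lt b a -> nat -> M) (x : nat -> M) : Prop :=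
  forall g' : A -> nat -> M, (forall b (ba : lt b a), g' b = h b ba) ->
    g' a = x -> elementary_on (upto a) g'.

Let next a (h : forall b, lt b a -> nat -> M) : nat -> M :=
  if pselect (exists x, next_spec h x) is left ex then sval (cid ex)
  else fun=> m0.

(** The recursion along [lt]; the step of [elementary_extend] applies because
the initial segments are countable. *)
Theorem elementary_transfer : exists g, elementary_on setT g.
Proof.
pose g := Fix lt_wf (fun=> nat -> M) next.
have gE a : g a = next (fun b (_ : lt b a) => g b).
  rewrite /g Fix_eq// => x h h' hh'; congr next.
  by apply: functional_extensionality_dep => b; apply: functional_extensionality_dep.
have greatest (s : seq A) : s = [::] \/ exists2 a, List.In a s &
    forall b, List.In b s -> upto a b.
  elim: s => [|x s [->|[a sa aP]]]; first by left.
    by right; exists x; [left|move=> b /= [->|//]; left].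
  right; have [xa|xa|ax] := lt_total x a.
  - by exists a; [right|move=> b /= [<-|/aP//]; right].
  - by exists a; [right|move=> b /= [<-|/aP//]; left].
  - exists x; [by left|move=> b /= [->|/aP [->|ba]]]; [by left|by right|].
    by right; exact: lt_trans ax.
have uptoP a : elementary_on (upto a) g.
  elim/(well_founded_ind lt_wf): a => a IH.
  have ga : elementary_on [set b | lt b a] g.
    apply: (@elementary_finite [set upto b | b in [set b | lt b a]]).
      by move=> _ [b ba <-]; exact: IH.
    move=> s sa; have [->|[b sb bP]] := greatest s.
      by exists set0 => //; left.
    by exists (upto b) => //; right; exists b => //; exact: sa.
  have [x xP] := elementary_extend a (lt_countable a) ga.
  have ex : exists x, next_spec (fun b (_ : lt b a) => g b) x.
    by exists x => g' g'b; apply: xP => b /g'b.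
  have := gE a; rewrite /next; case: pselect => // {}ex.
  by case: cid => /= y yP /(yP g); apply.
exists g; apply: (@elementary_finite (range upto)).
  by move=> _ [a _ <-].
move=> s _; have [->|[b sb bP]] := greatest s; first by exists set0 => //; left.
by exists (upto b) => //; right; exists b.
Qed.

End Recursion.
End Transfer.

(** * Well-orders with countable initial segments *)

Lemma countableU1 (T : Type) (a : T) (S : set T) :
  countable S -> countable (a |` S).
Proof.
move=> Sc; have -> : a |` S = \bigcup_(b in [set: bool]) (if b then [set a] else S).
  apply/seteqP; split=> x /= => [[->|Sx]|[[] _]]; [by exists true|by exists false| |].
    by left.
  by right.
by apply: bigcup_countable => // -[].
Qed.

Definition strict_well_order (T : Type) (lt : T -> T -> Prop) : Prop :=
  [/\ well_founded lt, forall a b c, lt a b -> lt b c -> lt a c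
    & forall a b, [\/ lt a b, a = b | lt b a]].

Definition omega1_like (T : Type) (lt : T -> T -> Prop) : Prop :=
  strict_well_order lt /\ forall a, countable [set b | lt b a].

Lemma strict_well_order_exists (T : Type) :
  exists lt : T -> T -> Prop, strict_well_order lt.
Proof.
elim/Pchoice: T => T.
have [R Rwo] := well_ordering_principle T.
have Rch : wo_chain R predT by move=> A _; exact: Rwo.
have Rtot x y : R x y || R y x by exact: (wo_chainW Rch).
have Ranti x y : R x y -> R y x -> x = y.
  by move=> xy yx; apply: (wo_chain_antisymmetric Rch) => //; rewrite xy yx.
have Rtr x y z : R x y -> R y z -> R x z.
  move=> xy yz; have [|m [[mA mlb] _]] := Rwo (mem [:: x; y; z]).
    by exists x; rewrite inE eqxx.
  have mx : R m x by apply: mlb; rewrite !inE eqxx.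
  have my : R m y by apply: mlb; rewrite !inE eqxx ?orbT.
  have mz : R m z by apply: mlb; rewrite !inE eqxx ?orbT.
  move: mA; rewrite !inE => /or3P[] /eqP mE; subst m => //.
    by rewrite (Ranti x y).
  by rewrite (Ranti y z) in xy.
exists (fun x y => R x y /\ x <> y); split.
- move=> a; apply: contrapT => na.
  have [|m [[mA mlb] _]] := Rwo [pred x | `[< ~ Acc (fun x y => R x y /\ x <> y) x >]].
    by exists a; apply/asboolP.
  move: mA => /asboolP; apply; constructor => y [ym yNm].
  apply: contrapT => ny; apply: yNm; apply: (Ranti _ _ ym); apply: mlb.
  exact/asboolP.
- move=> a b c [ab aNb] [bc bNc]; split; first exact: Rtr bc.
  by move=> ac; subst c; apply: aNb; exact: Ranti.
- move=> a b; have [->|ab] := eqVneq a b; first by constructor 2.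
  have /orP[H|H] := Rtot a b; [constructor 1|constructor 3]; split=> //.
    exact/eqP.
  by apply/eqP; rewrite eq_sym.
Qed.

(** Order A by the value of r and, inside each of its countable fibres, by an
arbitrary well-order. *)
Lemma omega1_like_lift (T A : Type) (lt : T -> T -> Prop) (r : A -> T) :
  omega1_like lt -> (forall t, countable [set a | r a = t]) ->
  exists lt' : A -> A -> Prop, omega1_like lt'.
Proof.
move=> [[ltwf lttr lttot] ltc] rc.
have [w [wwf wtr wtot]] := strict_well_order_exists A.
have ltirr t : ~ lt t t.
  by elim/(well_founded_ind ltwf): t => t IH tt; exact: (IH t).
exists (fun a b => lt (r a) (r b) \/ r a = r b /\ w a b); split; first split.
- suff H t : forall a, r a = t ->
      Acc (fun a b => lt (r a) (r b) \/ r a = r b /\ w a b) a.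
    by move=> a; exact: H.
  elim/(well_founded_ind ltwf): t => t IHt a.
  elim/(well_founded_ind wwf): a => a IHa ra; constructor => b [ba|[rb ba]].
    by apply: (IHt (r b)) => //; rewrite -ra.
  by apply: IHa => //; rewrite rb.
- move=> a b c [ab|[rab ab]] [bc|[rbc bc]].
  + by left; exact: lttr bc.
  + by left; rewrite -rbc.
  + by left; rewrite rab.
  + by right; split; [rewrite rab|exact: wtr bc].
- move=> a b; have [ab|ab|ba] := lttot (r a) (r b).
  + by constructor 1; left.
  + have [wab|->|wba] := wtot a b; [|by constructor 2|].
    * by constructor 1; right.
    * by constructor 3; right.
  + by constructor 3; left.
- move=> a; pose D := r a |` [set t | lt t (r a)].
  have : countable (\bigcup_(t in D) [set b | r b = t]).
    by apply: bigcup_countable => [|t _]; [apply: countableU1|exact: rc].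
  apply: sub_countable; apply: subset_card_le => b /= [ba|[rb _]].
    by exists (r b) => //; right.
  by exists (r b) => //; left; rewrite rb.
Qed.

(** The maximum of the two components is a map to which [omega1_like_lift]
applies. *)
Lemma omega1_like_pair (T : Type) (lt : T -> T -> Prop) :
  omega1_like lt -> exists lt' : T * T -> T * T -> Prop, omega1_like lt'.
Proof.
move=> ltO; have [[ltwf lttr lttot] ltc] := ltO.
pose r (p : T * T) := if pselect (lt p.1 p.2) then p.2 else p.1.
apply: (omega1_like_lift ltO (r := r)) => t.
pose D := t |` [set s | lt s t].
have : countable (D `*` D) by apply: countableX; apply: countableU1.
apply: sub_countable; apply: subset_card_le => -[x y] /=; rewrite /r /=.
case: pselect => [xy|nxy] /= E; rewrite /D -E; split; [by right|by left|by left|].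
by have [|->|] := lttot x y; [|left|right].
Qed.

(** In a well-order of B, take the least element with an uncountable initial
segment, if there is one: B embeds in this segment, all of whose proper initial
segments are countable. *)
Lemma aleph1_omega1_like (T : Type) (B : set T) : card_aleph1 B ->
  exists lt : set_type B -> set_type B -> Prop, omega1_like lt.
Proof.
move=> [Bunc Bmin].
have [lt ltwo] := strict_well_order_exists (set_type B).
have [ltwf lttr lttot] := ltwo.
have [ltc|] := pselect (forall b, countable [set c | lt c b]); first by exists lt.
move=> /existsNP[b].
elim/(well_founded_ind ltwf): b => b IH bunc.
have [[c cb cunc]|allc] := pselect (exists2 c, lt c b & ~ countable [set d | lt d c]).
  exact: (IH c).
have {}allc c : lt c b -> countable [set d | lt d c].
  by move=> cb; apply: contrapT => cunc; apply: allc; exists c.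
pose S := set_type [set c | lt c b].
pose ltS (x y : S) := lt (set_val x) (set_val y).
have ltSO : omega1_like ltS.
  split; first split.
  - move=> x; move: {2}(set_val x) (erefl (set_val x)) => t.
    elim/(well_founded_ind ltwf): t x => t IHt x xt; constructor => y yx.
    by apply: (IHt (set_val y)) => //; rewrite -xt.
  - by move=> x y z; exact: lttr.
  - move=> x y; have [xy|xy|xy] := lttot (set_val x) (set_val y).
    + by constructor 1.
    + by constructor 2; exact: val_inj.
    + by constructor 3.
  - move=> x; have /countable_injP[j jinj] := allc _ (set_mem (valP x)).
    apply/countable_injP; exists (fun y => j (set_val y)) => y z.
    rewrite !inE => yx zx jyz; apply: val_inj; apply: jinj => //; exact/mem_set.
have /card_leP[i] := Bmin _ _ bunc.
apply: (omega1_like_lift ltSO (r := i)) => t.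
have [->//|/set0P[x <-]] := eqVneq [set a | i a = t] set0.
rewrite (_ : [set a | _] = [set x])//; apply/seteqP; split=> [a /= ia|a /= -> //].
by apply: (@inj _ _ _ i) => //; rewrite inE.
Qed.
Local Open Scope ring_scope.

(** * Curves through a continuum *)

Fixpoint chain (T : Type) (N : T -> T -> Prop) (x : T) (p : seq T) : Prop :=
  if p is y :: q then N x y /\ chain N y q else True.

Lemma chain_cat (T : Type) (N : T -> T -> Prop) x p q :
  chain N x (p ++ q) <-> chain N x p /\ chain N (last x p) q.
Proof.
elim: p x => [|y p IH] x /=; first by split=> [|[]].
by rewrite IH; tauto.
Qed.

Section Chains.
Variables (X : topologicalType) (N : X -> X -> Prop).
Hypothesis N_sym : forall x y, N x y -> N y x.
Hypothesis N_nbhs : forall x, nbhs x [set y | N x y].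

(** The set of points that can be reached from x is open, and so is its
complement. *)
Lemma connected_chain : connected [set: X] ->
  forall x y, exists2 p, chain N x p & last x p = y.
Proof.
move=> Xconn x; pose C := [set y | exists2 p, chain N x p & last x p = y].
suff CT : C = setT by move=> y; have : C y by rewrite CT.
have step y z : C y -> N y z -> C z.
  move=> [p px py] yz; exists (rcons p z); last by rewrite last_rcons.
  by rewrite -cats1; apply/chain_cat; rewrite py.
apply: Xconn; first by exists x, [::].
- exists C; last by rewrite setTI.
  rewrite openE => y Cy; apply: filterS (N_nbhs y) => z; exact: step.
- exists C; last by rewrite setTI.
  rewrite -[C]setCK; apply: open_closedC; rewrite openE => y nCy.
  apply: filterS (N_nbhs y) => z yz Cz; apply: nCy.
  by apply: step Cz _; exact: N_sym.
Qed.

Lemma compact_net : compact [set: X] ->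
  exists l : seq X, forall x, exists2 y, y \in l & N y x.
Proof.
move=> Xcpt; pose far (l : seq X) := [set x | forall y, y \in l -> ~ N y x].
apply: contrapT => nonet.
have farF : ProperFilter (filter_from setT far).
  apply: filter_from_proper => [|l _].
    apply: filter_fromT_filter; first by exists [::].
    move=> l l'; exists (l ++ l') => x xl; split=> y yl; apply: xl;
      by rewrite mem_cat yl ?orbT.
  apply: contrapT => nfar; apply: nonet; exists l => x.
  apply: contrapT => nx; apply: nfar; exists x => y yl yx; apply: nx.
  by exists y.
have [|x [_ xfar]] := Xcpt (filter_from setT far) _; first exact: filterT.
have [|z [zfar xz]] := xfar (far [:: x]) _ _ (N_nbhs x); first by exists [:: x].
by apply: (zfar x) => //; rewrite inE.
Qed.

Lemma chain_through : connected [set: X] -> forall (l : seq X) (x : X),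
  exists2 p, chain N x p & {subset l <= x :: p}.
Proof.
move=> Xconn; elim=> [|y l IH] x; first by exists [::].
have [p xp py] := connected_chain Xconn x y; have [q yq lq] := IH y.
exists (p ++ q); first by apply/chain_cat; rewrite py.
have yxp : y \in x :: p by rewrite -py mem_last.
move=> z; rewrite inE -cat_cons mem_cat => /predU1P[->|/lq].
  by rewrite yxp.
by rewrite inE => /predU1P[->|->]; rewrite ?yxp ?orbT.
Qed.

End Chains.

Section Polyline.
Variables (R : realType) (X : Type).

Definition clamp (t : R) : R := Num.max 0 (Num.min 1 t).

Lemma clampE t : clamp t = if t <= 0 then 0 else if t <= 1 then t else 1.
Proof.
by rewrite /clamp; case: (leP 1 t) => t1; case: (leP 0 _) => t0;
  case: (leP t 0) => ?; case: (leP t 1) => ? //; lra.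
Qed.

Lemma clamp_itv t : 0 <= clamp t <= 1.
Proof. by rewrite clampE; case: (leP t 0) => ?; case: (leP t 1) => ?; lra. Qed.

Lemma clamp_id t : 0 <= t <= 1 -> clamp t = t.
Proof. by rewrite clampE; case: (leP t 0) => ?; case: (leP t 1) => ?; lra. Qed.

Lemma clamp_ge1 t : 1 <= t -> clamp t = 1.
Proof. by rewrite clampE; case: (leP t 0) => ?; case: (leP t 1) => ?; lra. Qed.

Lemma clamp_le0 t : t <= 0 -> clamp t = 0.
Proof. by rewrite clampE; case: (leP t 0) => ?; case: (leP t 1) => ?; lra. Qed.

Lemma clamp_dist s t : `|clamp s - clamp t| <= `|s - t|.
Proof.
rewrite !clampE ler_norml; have := ler_norm (s - t).
have := ler_norm (t - s); rewrite distrC.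
by case: (leP s 0) => ?; case: (leP s 1) => ?;
  case: (leP t 0) => ?; case: (leP t 1) => ?; lra.
Qed.

(** The curve equal to phi at the i-th vertex of x :: p when t = i, affine between
consecutive vertices and constant outside [0, size p]. *)
Fixpoint polyline (phi : X -> R) (x : X) (p : seq X) (t : R) : R :=
  if p is y :: q
  then (phi x - phi y) * (1 - clamp t) + polyline phi y q (t - 1)
  else phi x.

Lemma polyline_le0 phi x p t : t <= 0 -> polyline phi x p t = phi x.
Proof.
elim: p x t => [|y p IH] x t //= t0.
by rewrite clamp_le0// IH; lra.
Qed.

Lemma polyline_shift phi x y p t : 0 <= t ->
  polyline phi x (y :: p) (t + 1) = polyline phi y p t.
Proof. by move=> t0 /=; rewrite clamp_ge1 ?addrK ?lerDr//; lra. Qed.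

Lemma clamp_continuous : continuous clamp.
Proof.
move=> t; apply: (@continuous_max R R (cst 0) (Num.min 1)).
  exact: cvg_cst.
by apply: (@continuous_min R R (cst 1) id); [exact: cvg_cst|exact: cvg_id].
Qed.

Lemma polyline_continuous phi x p : continuous (polyline phi x p).
Proof.
elim: p x => [|y p IH] x t /=; first exact: cvg_cst.
apply: cvgD.
  apply: cvgM; first exact: cvg_cst.
  by apply: cvgB; [exact: cvg_cst|exact: clamp_continuous].
apply: (@cvg_comp _ _ _ (fun t => t - 1) (polyline phi y p)); last exact: IH.
by apply: cvgB; [exact: cvg_id|exact: cvg_cst].
Qed.

(** The point z is chosen independently of i: the polylines of all the
functions are traversed simultaneously. *)
Lemma polyline_near (I : Type) (F : set I) (phi : I -> X -> R) (eps : R) x p :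
  0 <= eps ->
  chain (fun x y => forall i, F i -> `|phi i x - phi i y| <= eps) x p ->
  forall t, exists z, forall i, F i -> `|polyline (phi i) x p t - phi i z| <= eps.
Proof.
move=> eps0; elim: p x => [|y p IH] x /=.
  by move=> _ t; exists x => i _; rewrite subrr normr0.
move=> [xy /IH{}IH] t; have [t1|t1] := leP t 1; last first.
  have [z zP] := IH (t - 1); exists z => i Fi.
  by rewrite /= (clamp_ge1 (ltW t1)) subrr mulr0 add0r zP.
exists x => i Fi; rewrite /= polyline_le0 ?subr_le0//.
rewrite (_ : _ - _ = (phi i y - phi i x) * clamp t); last by ring.
rewrite normrM distrC -[eps]mulr1; apply: ler_pM => //; first exact: xy.
by have := clamp_itv t; rewrite ler_norml; lra.
Qed.

End Polyline.

Lemma polyline_visit (R : realType) (X : eqType) x (p : seq X) y : y \in x :: p ->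
  exists2 t : R, 0 <= t <= (size p)%:R &
    forall phi, polyline phi x p t = phi y.
Proof.
elim: p x => [|z p IH] x.
  by rewrite inE => /eqP ->; exists 0 => //=; rewrite lexx.
rewrite inE => /predU1P[->|/IH[t /andP[t0 tp] tP]].
  by exists 0 => [|phi]; rewrite ?lexx ?ler0n// polyline_le0.
exists (t + 1) => [|phi]; last by rewrite polyline_shift.
by rewrite /= -natr1 lerD2r tp addr_ge0.
Qed.

Section Curves.
Variable R : realType.

Lemma clamp_unit (t : R) : clamp t \in `[0 : R, 1]%classic.
Proof. by apply/mem_set; rewrite /= in_itv /= clamp_itv. Qed.

Definition to_unit (t : R) : unitI R := SigSub (clamp_unit t).

Lemma to_unit_continuous : continuous to_unit.
Proof.
apply: (@continuous_comp_initial (set_type `[0 : R, 1]%classic) _ _ set_val).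
exact: clamp_continuous.
Qed.

Lemma unit_val_continuous : continuous (val : unitI R -> R).
Proof. exact: initial_continuous. Qed.

Lemma nbhs_close_on (T : topologicalType) (A : choiceType) (s : seq A)
    (phi : A -> T -> R) (eps : R) :
  (forall a, continuous (phi a)) -> forall x, 0 < eps ->
  nbhs x [set y | forall a, a \in s -> `|phi a x - phi a y| <= eps].
Proof.
move=> phi_cont x eps0; elim: s => [|a s IH].
  by apply: filterS filterT => y _ a.
have /cvgrPdist_le/(_ _ eps0) xa := phi_cont a x.
apply: filterS (filterI xa IH) => y [/= ya ys] b.
by rewrite inE => /predU1P[->|/ys].
Qed.

(** A chain with steps at most eps (measured by the phi_a with a in s) that
visits an eps-net of X yields a polyline; it is reparametrized by [0,1], and
clamped so that it takes its values there. *)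
Lemma curve_through_continuum (X : topologicalType) (A : choiceType)
    (phi : A -> X -> R) (s : seq A) (eps : R) :
  [set: X] !=set0 -> compact [set: X] -> connected [set: X] ->
  (forall a, continuous (phi a)) -> (forall a x, 0 <= phi a x <= 1) -> 0 < eps ->
  exists h : A -> continuousType (unitI R) (unitI R),
    (forall t, exists z, forall a, a \in s -> `|val (h a t) - phi a z| <= eps) /\
    (forall z, exists t, forall a, a \in s -> `|val (h a t) - phi a z| <= eps).
Proof.
move=> [x0 _] Xcpt Xconn phi_cont phi01 eps0.
pose N x y := forall a, [set` s] a -> `|phi a x - phi a y| <= eps.
have N_sym x y : N x y -> N y x by move=> xy a /xy; rewrite distrC.
have N_nbhs x : nbhs x [set y | N x y].
  by exact: nbhs_close_on.
have [l lnet] := compact_net N_nbhs Xcpt.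
have [p pchain pl] := chain_through N_sym N_nbhs Xconn l x0.
pose g a t := to_unit (polyline (phi a) x0 p ((size p)%:R * val (t : unitI R))).
have g_cont a : continuous (g a).
  move=> t; apply: (@continuous_comp _ _ _ (fun t : unitI R =>
    polyline (phi a) x0 p ((size p)%:R * val t)) to_unit); last first.
    exact: to_unit_continuous.
  apply: (@continuous_comp _ _ _ (fun t : unitI R =>
    (size p)%:R * val t) (polyline (phi a) x0 p)); last exact: polyline_continuous.
  apply: (@cvg_comp _ _ _ (val : unitI R -> R)); first exact: unit_val_continuous.
  exact: mulrl_continuous.
have gd a t z : `|val (g a t) - phi a z| <=
    `|polyline (phi a) x0 p ((size p)%:R * val t) - phi a z|.
  by have := clamp_dist (polyline (phi a) x0 p ((size p)%:R * val t)) (phi a z);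
    rewrite (clamp_id (phi01 a z)).
exists (fun a => mkcts (@g_cont a)); split=> [t|z].
  have [z zP] := polyline_near (ltW eps0) pchain ((size p)%:R * val t).
  by exists z => a sa; apply: le_trans (gd a t z) _; exact: zP.
have [y yl yz] := lnet z.
have [t /andP[t0 tp] tP] := polyline_visit R (pl _ yl).
exists (to_unit (t / (size p)%:R)) => a sa.
apply: le_trans (gd _ _ _) _.
rewrite [val _]clamp_id; last first.
  rewrite divr_ge0 //=; have [p0|p0] := eqVneq (size p) 0.
    by rewrite p0 invr0 mulr0 ler01.
  by rewrite ler_pdivrMr ?mul1r// ltr0n lt0n.
have [p0|p0] := eqVneq (size p) 0.
  move: tp tP; rewrite p0 mul0r => tp /(_ (phi a)).
  by rewrite (le_anti (introT andP (conj tp t0))) => ->; exact: yz.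
by rewrite mulrC divfK ?pnatr_eq0// tP; exact: yz.
Qed.

End Curves.
(** * Approximation of X along the ultrafilter *)

Section ApproximatingFamily.
Variable R : realType.
Local Notation II := (continuousType (unitI R) (unitI R)).

Lemma inv_succ_gt0 k : 0 < k.+1%:R^-1 :> R.
Proof. by rewrite invr_gt0 ltr0n. Qed.

Lemma ler_inv_succ k j : (k <= j)%N -> 2 * j.+1%:R^-1 <= 2 * k.+1%:R^-1 :> R.
Proof. by move=> kj; rewrite ler_pM2l// lef_pV2 ?posrE ?ltr0n// ler_nat. Qed.

(** The relations of the language on C(I,I): the curve with components [ms] meets
the closed box with rational centre [l.1] and radius 1 / (l.2 + 1). *)
Definition enters_box (l : seq rat * nat) (ms : seq II) : Prop :=
  exists t : unitI R, forall mq, mq \in zip ms l.1 ->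
    `|val (mq.1 t) - ratr mq.2| <= l.2.+1%:R^-1.

Lemma rat_approx (A : Type) (v : A -> R) (eps : R) : 0 < eps ->
  exists q : A -> rat, forall a, `|v a - ratr (q a)| <= eps.
Proof.
move=> eps0.
have H a : exists q : rat, `|v a - ratr q| <= eps.
  have [|q] := @rat_in_itvoo R (v a - eps) (v a + eps); first by lra.
  by rewrite in_itv /= => qv; exists q; rewrite ler_norml; lra.
by have [q qP] := choice H; exists q.
Qed.

(** The two conclusions are the two halves of convergence in the Hausdorff
metric: the curves avoid the boxes that the image of X avoids, and come near each
of its points. *)
Lemma approximating_family (X : topologicalType) (A : choiceType)
    (lt : A -> A -> Prop) (phi : A -> X -> R) (u : set_system nat) :
  omega1_like lt -> UltraFilter u -> (forall n, u [set k | n <= k]%N) ->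
  [set: X] !=set0 -> compact [set: X] -> connected [set: X] ->
  (forall a, continuous (phi a)) -> (forall a x, 0 <= phi a x <= 1) ->
  exists g : A -> nat -> II,
    (forall (s : seq A) (v : A -> R) k,
      ~ (exists x, forall a, a \in s -> `|phi a x - v a| <= 2 * k.+1%:R^-1) ->
      u [set n | ~ exists t, forall a, a \in s ->
        `|val (g a n t) - v a| <= k.+1%:R^-1 / 2]) /\
    (forall (s : seq A) x k,
      u [set n | exists t, forall a, a \in s ->
        `|val (g a n t) - phi a x| <= 2 * k.+1%:R^-1]).
Proof.
move=> [[lt_wf lt_trans lt_total] ltc] uU ufree X0 Xcpt Xconn phi_cont phi01.
have curve (p : seq A * nat) :=
  curve_through_continuum p.1 X0 Xcpt Xconn phi_cont phi01 (inv_succ_gt0 p.2).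
have [h hP] := choice curve.
pose f a p := h p a.
pose tail (p : seq A * nat) := [set p' : seq A * nat |
  {subset p.1 <= p'.1} /\ (p.2 <= p'.2)%N].
have tailF : ProperFilter (filter_from setT tail).
  apply: filter_from_proper => [|p _]; last by exists p; split.
  apply: filter_fromT_filter; first by exists ([::], 0%N).
  move=> [s k] [s' k']; exists (s ++ s', maxn k k') => -[r j] [/= sr kj].
  split; split=> /=.
  - by move=> a sa; apply: sr; rewrite mem_cat sa.
  - by apply: leq_trans kj; rewrite leq_maxl.
  - by move=> a sa; apply: sr; rewrite mem_cat sa orbT.
  - by apply: leq_trans kj; rewrite leq_maxr.
(* The ultrapower by V contains a family approximating X perfectly. *)
have [V [VU tailV]] := ultraFilterLemma tailF.
have m0 : II := [the II of idfun].
have [g gP] := elementary_transfer enters_box m0 VU uU ufree f lt_wf lt_trans lt_total ltc.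
(* The transferred information: the families enter the same rational boxes. *)
have enters_boxP (s : seq A) (q : A -> rat) k :
    V [set p | exists t, forall a, a \in s ->
      `|val (f a p t) - ratr (q a)| <= k.+1%:R^-1] <->
    u [set n | exists t, forall a, a \in s ->
      `|val (g a n t) - ratr (q a)| <= k.+1%:R^-1].
  have E I (G : A -> I -> II) : [set i | exists t, forall a, a \in s ->
      `|val (G a i t) - ratr (q a)| <= k.+1%:R^-1] =
      [set i | sat enters_box (env m0 G (onth s) i)
        (FRel (map q s, k) (iota 0 (size s)))].
    apply/funext => i; rewrite /= /enters_box /=.
    have -> : map (env m0 G (onth s) i) (iota 0 (size s)) = [seq G a i | a <- s].
      apply: (@eq_from_nth _ m0) => [|j]; rewrite !size_map size_iota// => js.
      rewrite (nth_map 0%N) ?size_iota// nth_iota// add0n /env.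
      have := onthTE s j; rewrite js; case E : (onth s j) => [a|//] _.
      by rewrite (nth_map a)// (onth_nth _ _ _ _ E).
    rewrite zip_map; apply/propext; split=> -[t tP]; exists t.
      by move=> _ /mapP[a sa ->]; exact: tP.
    by move=> a sa; apply: (tP (G a i, q a)); apply/mapP; exists a.
  by rewrite !E; apply: gP.
have half k : (k.*2.+1).+1%:R^-1 = k.+1%:R^-1 / 2 :> R.
  by rewrite -doubleS -mul2n natrM invfM mulrC.
exists g; split=> [s v k nov|s x k].
- have [q qP] := @rat_approx A v (k.+1%:R^-1 / 2) (divr_gt0 (inv_succ_gt0 k) (ltr0Sn R 1)).
  have nV : ~ V [set p | exists t, forall a, a \in s ->
      `|val (f a p t) - ratr (q a)| <= k.+1%:R^-1].
    move=> Vs; have /tailV Vt : filter_from setT tail (tail (s, k.*2.+1)).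
      by exists (s, k.*2.+1).
    have [p [[t tP] [/= sp kp]]] := filter_ex (filterI Vs Vt).
    apply: nov; have [/(_ t)[z zP] _] := hP p; exists z => a sa.
    have := zP a (sp _ sa); have := tP a sa; have := qP a.
    have : p.2.+1%:R^-1 <= k.+1%:R^-1 / 2 :> R.
      by rewrite -half lef_pV2 ?posrE ?ltr0n// ler_nat.
    rewrite /f /= !ler_norml.
    by move: (k.+1%:R^-1 : R) (p.2.+1%:R^-1 : R) => r e; lra.
  have : u [set n | ~ exists t, forall a, a \in s ->
      `|val (g a n t) - ratr (q a)| <= k.+1%:R^-1].
    by apply/(ultra_not _ uU) => /enters_boxP.
  apply: filterS => n nt [t tP]; apply: nt; exists t => a sa.
  have := tP a sa; have := qP a; rewrite !ler_norml.
  by move: (k.+1%:R^-1 : R) => r; lra.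
- have [q qP] := @rat_approx A (phi^~ x) (k.+1%:R^-1 / 2)
    (divr_gt0 (inv_succ_gt0 k) (ltr0Sn R 1)).
  have Vs : V [set p | exists t, forall a, a \in s ->
      `|val (f a p t) - ratr (q a)| <= k.+1%:R^-1].
    have /tailV : filter_from setT tail (tail (s, k.*2.+1)) by exists (s, k.*2.+1).
    apply: filterS => p [/= sp kp]; have [_ /(_ x)[t tP]] := hP p.
    exists t => a sa; have := tP a (sp _ sa); have := qP a.
    have : p.2.+1%:R^-1 <= k.+1%:R^-1 / 2 :> R.
      by rewrite -half lef_pV2 ?posrE ?ltr0n// ler_nat.
    rewrite /f /= !ler_norml.
    by move: (k.+1%:R^-1 : R) (p.2.+1%:R^-1 : R) => r e; lra.
  move/enters_boxP: Vs; apply: filterS => n [t tP]; exists t => a sa.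
  have := tP a sa; have := qP a; have := inv_succ_gt0 k.
  by rewrite !ler_norml; move: (k.+1%:R^-1 : R) => r; lra.
Qed.

End ApproximatingFamily.
(** * Functions and compactness *)

Lemma free_ultrafilter_tail (u : set_system nat) :
  UltraFilter u -> nonprincipal u -> forall n, u [set k | n <= k]%N.
Proof.
move=> uU ufree.
have uN1 n : u (~` [set n]).
  have [un|//] := in_ultra_setVsetC [set n] uU; case: (ufree n).
  apply/seteqP; split=> S.
    move=> uS x ->; have [y [Sy yn]] := filter_ex (filterI uS un).
    by rewrite -yn.
  by move=> nS; apply: filterS un.
elim=> [|n IH]; first by apply: filterS filterT.
by apply: filterS (filterI IH (uN1 n)) => k [/= nk /eqP kn]; rewrite ltn_neqAle eq_sym kn.
Qed.

(** For each pair of basic open sets, choose a function that has no value in common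
on the two sets, whenever one exists.  Urysohn functions show
that these choices separate points. *)
Lemma separating_family (R : realType) (X : topologicalType) (B : set (set X)) :
  hausdorff_space X -> compact [set: X] -> basis B ->
  exists phi : set_type B * set_type B -> X -> R,
    [/\ forall a, continuous (phi a), forall a x, 0 <= phi a x <= 1
      & forall x y, (forall a, phi a x = phi a y) -> x = y].
Proof.
move=> Xhaus Xcpt [Bopen Bbasis].
pose good (a : set_type B * set_type B) (f : X -> R) :=
  [/\ continuous f, forall x, 0 <= f x <= 1
    & forall x y, set_val a.1 x -> set_val a.2 y -> f x != f y].
have H a : exists f : X -> R, [/\ continuous f, forall x, 0 <= f x <= 1
    & (exists f', good a f') -> good a f].
  have [[f fa]|no] := pselect (exists f, good a f).
    by case: (fa) => fc f01 _; exists f.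
  exists (cst 0); split=> // [x|x]; first exact: cvg_cst.
  by rewrite lexx ler01.
have [phi phiP] := choice H.
exists phi; split=> [a|a x|x y xy]; [by case: (phiP a)|by case: (phiP a)|].
apply: contrapT => /eqP xNy.
have sep := (@normal_separatorP R X).1 (compact_normal Xhaus Xcpt) [set x] [set y].
have cl := accessible_closed_set1 (hausdorff_accessible Xhaus).
have xy0 : [set x] `&` [set y] = set0.
  by apply/seteqP; split=> // z [/= ->] /eqP; rewrite (negPf xNy).
have [f [fc f01 fx fy]] := (@uniform_separatorP _ R _ _).1 (sep (cl _) (cl _) xy0).
have {}fx : f x = 0 by apply: fx; exists x.
have {}fy : f y = 1 by apply: fy; exists y.
have bx : nbhs x [set z | f z < 1/2].
  by apply: (fc x [set r | r < 1/2]); apply: lt_nbhsl; rewrite fx; lra.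
have by_ : nbhs y [set z | 1/2 < f z].
  by apply: (fc y [set r | 1/2 < r]); apply: lt_nbhsr; rewrite fy; lra.
have [b1 [Bb1 b1x] b1f] := Bbasis x _ bx.
have [b2 [Bb2 b2y] b2f] := Bbasis y _ by_.
pose a : set_type B * set_type B := (SigSub (mem_set Bb1), SigSub (mem_set Bb2)).
have [_ _ []] := phiP a.
  exists f; split=> // [z|z w].
    by have := f01 (f z) (imageT f z); rewrite /= in_itv.
  by move=> /b1f/= zl /b2f/= wl; rewrite (lt_eqF (lt_trans zl wl)).
by move=> _ _ /(_ x y b1x b2y); rewrite xy eqxx.
Qed.

(** Compactness replaces infinitely many equations by finitely many approximate
ones.  With [O] empty, this says that a point [v] outside the image of [phi] is
already at positive distance from it in finitely many coordinates. *)
Lemma compact_fibre (R : realType) (X : topologicalType) (A : choiceType)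
    (phi : A -> X -> R) (v : A -> R) (O : set X) :
  compact [set: X] -> (forall a, continuous (phi a)) -> open O ->
  (forall x, (forall a, phi a x = v a) -> O x) ->
  exists (s : seq A) k, forall x,
    (forall a, a \in s -> `|phi a x - v a| <= 2 * k.+1%:R^-1) -> O x.
Proof.
move=> Xcpt phi_cont oO fibO; apply: contrapT => no.
pose K (i : seq A * nat) := [set x | ~ O x /\
  forall a, a \in i.1 -> `|phi a x - v a| <= 2 * i.2.+1%:R^-1].
have KF : ProperFilter (filter_from setT K).
  apply: filter_from_proper => [|[s k] _].
    apply: filter_fromT_filter; first by exists ([::], 0%N).
    move=> [s k] [s' k']; exists (s ++ s', maxn k k') => x [/= nO xs].
    split; split=> //= a sa; (apply: le_trans (xs a _) _;
      first by rewrite mem_cat sa ?orbT); apply: ler_inv_succ;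
      by rewrite ?leq_maxl ?leq_maxr.
  apply: contrapT => nK; apply: no; exists s, k => x xs.
  by apply: contrapT => nO; apply: nK; exists x; split.
have [|x [_ xK]] := Xcpt (filter_from setT K) _; first exact: filterT.
have Kin i : filter_from setT K (K i) by exists i.
have Ox : O x.
  apply: fibO => a; apply/eqP; rewrite -subr_eq0 -normr_le0.
  apply/ler_addgt0Pr => e e0; rewrite add0r.
  have [k] := @ltr_add_invr R 0 (e / 4) (divr_gt0 e0 (ltr0Sn R 3)).
  rewrite add0r => ke.
  have [y [[_ /(_ a (mem_head _ _)) ya] /(_ a (mem_head _ _)) xy]] :=
    xK _ _ (Kin ([:: a], k)) (nbhs_close_on [:: a] phi_cont x (divr_gt0 e0 (ltr0Sn R 1))).
  move: ya xy ke; rewrite /= !ler_norml; move: (k.+1%:R^-1 : R) => r; lra.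
have [y [[nO _] Oy]] := xK _ _ (Kin ([::], 0%N)) (open_nbhs_nbhs (conj oO Ox)).
exact: nO.
Qed.

Lemma set_type_compact (T : topologicalType) (K : set T) :
  compact K -> compact [set: set_type K].
Proof.
move=> Kcpt F FF _; pose G := [set S : set T | F (set_val @^-1` S)].
have GF : ProperFilter G by exact: (fmap_proper_filter set_val FF).
have [|p [Kp pG]] := Kcpt G GF.
  by apply: (@filterS _ F) filterT => x _; exact: set_valP.
exists (SigSub (mem_set Kp)); split=> // S W FS.
rewrite nbhsE => -[_ [[D oD <-] /= Dp] DW].
have GS : G (set_val @` (S : set (set_type K))).
  by apply: (@filterS _ F) FS => x Sx; exists x.
have [_ [[x Sx <-] Dx]] := pG _ _ GS (open_nbhs_nbhs (conj oD Dp)).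
by exists x; split=> //; exact: DW.
Qed.

Section Beta.
Variables (R : realType) (X : topologicalType).

(** The extension of [f] to the Stone-Cech compactification: as the latter
consists of points of a cube indexed by the functions, it is a projection. *)
Definition beta_coord (f : continuousType X (unitI R)) (z : beta R X) : R :=
  val ((set_val z : {ptws continuousType X (unitI R) -> unitI R}) f).

Lemma beta_coord_continuous f : continuous (beta_coord f).
Proof.
move=> z; apply: (@continuous_comp _ _ _
  (fun z : beta R X => (set_val z : {ptws _ -> unitI R}) f) val); last first.
  exact: unit_val_continuous.
apply: (@continuous_comp _ _ _ (set_val : beta R X -> {ptws _ -> unitI R})
  (fun w : {ptws _ -> unitI R} => w f)); first exact: initial_continuous.
exact: proj_continuous.
Qed.

Lemma beta_compact : compact [set: beta R X].
Proof.
apply: set_type_compact.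
apply: (@subclosed_compact _ _ [set w : {ptws continuousType X (unitI R) -> unitI R} |
  forall f, [set: unitI R] (w f)]) => //; first exact: closed_closure.
apply: (@tychonoff _ (fun=> unitI R) (fun=> setT)) => _.
exact: set_type_compact (@segment_compact R 0 1).
Qed.

End Beta.

(** As the integers are discrete, a sequence of maps on I is a map on M. *)
Lemma glue_continuous (R : realType) (h : nat -> continuousType (unitI R) (unitI R)) :
  continuous (fun p : Mspace R => h p.1 p.2).
Proof.
move=> [n t]; apply: (@cvg_trans _ ((fun p : Mspace R => h n p.2) @ (n, t))).
  apply: near_eq_cvg; exists ([set n], setT) => [|[m s] [/= -> _]//].
  by split; [exact: discrete_set1|exact: filterT].
apply: (@cvg_comp _ _ _ snd (h n)); first exact: cvg_snd.
exact: cts_fun.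
Qed.
(** * The theorem *)

Theorem mainTheorem8 (R : realType) (u : set_system nat)
  (uU : UltraFilter u) (u_free : nonprincipal u)
  (X : topologicalType) (cX : continuum X) (wX : weight_aleph1 X) :
  maps_onto (set_type (@I_u R u)) X.
Proof.
have ufree := free_ultrafilter_tail uU u_free.
have [X0 Xcpt Xconn Xhaus] := cX; have [B [Bbasis Baleph _]] := wX.
have [ltB /omega1_like_pair[lt ltO]] := aleph1_omega1_like Baleph.
have [phi [phi_cont phi01 phi_sep]] := separating_family R Xhaus Xcpt Bbasis.
have [g [g_in g_onto]] :=
  approximating_family ltO uU ufree X0 Xcpt Xconn phi_cont phi01.
pose G a : continuousType (Mspace R) (unitI R) :=
  mkcts (@glue_continuous R (g a)).
pose c a (z : set_type (@I_u R u)) := beta_coord (G a) (set_val z).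
have c_cont a : continuous (c a).
  move=> z; apply: (@continuous_comp _ _ _ set_val (beta_coord (G a))).
    exact: initial_continuous.
  exact: beta_coord_continuous.
(* F z exists: otherwise, along a set of u, the curves stay away from the point
   (c a z)_a, although z is in the closure of that part of M. *)
have /choice[F FP] : forall z, exists x, forall a, phi a x = c a z.
  move=> z; apply: contrapT => nox.
  have [|s [k sk]] := @compact_fibre R X _ phi (c ^~ z) set0 Xcpt phi_cont open0.
    by move=> x xz; apply: nox; exists x.
  have /g_in uN : ~ exists x, forall a, a \in s ->
      `|phi a x - c a z| <= 2 * k.+1%:R^-1.
    by move=> [x /sk].
  have zU := set_valP z _ uN.
  have zn := nbhs_close_on s (fun a => @beta_coord_continuous R _ (G a)) (set_val z)
    (divr_gt0 (inv_succ_gt0 R k) (ltr0Sn R 1)).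
  have [_ [[[n t] [/= nt _] <-] wz]] := zU _ zn.
  by apply: nt; exists t => a sa; rewrite distrC; exact: wz.
exists F; split.
- move=> z O; rewrite nbhsE => -[W [oW Wz] WO].
  have [|s [k sk]] := @compact_fibre R X _ phi (c ^~ z) W Xcpt phi_cont oW.
    move=> x xz; rewrite (_ : x = F z)//; apply: phi_sep => a.
    by rewrite FP xz.
  have zn := nbhs_close_on s c_cont z (mulr_gt0 (ltr0Sn R 1) (inv_succ_gt0 R k)).
  apply: filterS zn => w wz; apply: WO; apply: sk => a sa.
  by rewrite FP distrC; exact: wz.
- (* The points of M over a set of u at which the g_a approximate the phi_a x
     form a filter base; any cluster point in beta M is mapped to x. *)
  apply/seteqP; split=> // x _.
  pose K (i : set nat * (seq _ * nat)) := [set p : Mspace R | i.1 p.1 /\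
    forall a, a \in i.2.1 -> `|val (g a p.1 p.2) - phi a x| <= 2 * i.2.2.+1%:R^-1].
  pose D (i : set nat * (seq (set_type B * set_type B) * nat)) := u i.1.
  have KF : ProperFilter (filter_from D K).
    apply: filter_from_proper => [|[U [s k]] /= uU'].
      apply: filter_from_filter; first by exists (setT, ([::], 0%N)); exact: filterT.
      move=> [U [s k]] [U' [s' k']] uU1 uU2.
      exists (U `&` U', (s ++ s', maxn k k')); first exact: filterI.
      move=> p [/= [Up U'p] ps]; split; split=> //= a sa;
        (apply: le_trans (ps a _) _; first by rewrite mem_cat sa ?orbT);
        by apply: ler_inv_succ; rewrite ?leq_maxl ?leq_maxr.
    have [n [Un [t tP]]] := filter_ex (filterI uU' (g_onto s x k)).
    by exists (n, t).
  pose E := fmap (@beta_embed R (Mspace R)) (filter_from D K).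
  have EF : ProperFilter E by exact: fmap_proper_filter.
  have [|z [_ zE]] := @beta_compact R (Mspace R) E EF; first exact: filterT.
  have zI : I_u u z.
    move=> U uU' N zN; apply: zE zN; exists (U, ([::], 0%N)) => // p [/= Up _].
    by exists p.
  exists (SigSub (mem_set zI)) => //; apply: phi_sep => a; rewrite FP.
  apply/eqP; rewrite -subr_eq0 -normr_le0.
  apply/ler_addgt0Pr => e e0; rewrite add0r.
  have [k] := @ltr_add_invr R 0 (e / 4) (divr_gt0 e0 (ltr0Sn R 3)).
  rewrite add0r => ke.
  have zn := nbhs_close_on [:: a] (fun a => @beta_coord_continuous R _ (G a)) z
    (divr_gt0 e0 (ltr0Sn R 1)).
  have EK : E [set w | `|beta_coord (G a) w - phi a x| <= 2 * k.+1%:R^-1].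
    exists (setT, ([:: a], k)); first exact: filterT.
    by move=> [n t] [_ /= /(_ a (mem_head _ _))].
  have [w [wx /(_ a (mem_head _ _)) wz]] := zE _ _ EK zn.
  rewrite /c /= set_valE /=; move: wx wz ke; rewrite /= !ler_norml.
  by move: (k.+1%:R^-1 : R) => r; lra.
Qed.
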